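(* Let $\mathsf C_{\mathcal H}$ be the coproduct in $\mathsf{AtoMon}$ of a family $\mathcal H=\{H_i\}_{i\in I}$ of atomic monoids indexed by a non-empty set $I$. Define a set $\Gamma_{\mathcal H}$ of non-empty words over the alphabet $I$ as follows: (1) if there exist $i,j\in I$ with $i\ne j$ such that $H_i^\times$ and $H_j^\times$ are both non-trivial, then $\Gamma_{\mathcal H}$ is the set of all non-empty $I$-words; (2) if there is a unique $i\in I$ such that $H_i^\times$ is non-trivial, then $\Gamma_{\mathcal H}$ is the set of all non-empty $I$-words without two consecutive letters both equal to $i$; (3) otherwise, $\Gamma_{\mathcal H}$ is the set of all non-empty $I$-words any two consecutive letters of which are different. Then, for every positive integer $k$, $$\mathscr U_k(\mathsf C_{\mathcal H})=\bigcup_{i_1\ast\cdots\ast i_n\in\Gamma_{\mathcal H}}\ \bigcup_{\substack{k_1,\ldots,k_n\in\mathbb N^+\\ k_1+\cdots+k_n=k}}\bigl(\mathscr U_{k_1}(H_{i_1})+\cdots+\mathscr U_{k_n}(H_{i_n})\bigr).$$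
   Context: Monoids are not assumed commutative. For a monoid $H$, $H^\times$ is the group of units. An atom of $H$ is a non-unit $a\in H$ such that $a=xy$ with $x,y\in H$ implies $x\in H^\times$ or $y\in H^\times$; $\mathscr A(H)$ is the set of atoms. $H$ is atomic if every non-unit is a (non-empty, finite) product of atoms. $\mathsf{AtoMon}$ is the category whose objects are atomic monoids and whose morphisms are the monoid homomorphisms between atomic monoids sending atoms to atoms. The coproduct in $\mathsf{AtoMon}$ coincides with the coproduct (free product) $\mathsf C_{\mathcal H}$ of the $H_i$ in the category of monoids. For $x\in H$, the length set $\mathsf L_H(x)\subseteq\mathbb N$ is the set of all $k\in\mathbb N$ such that $x=a_1\cdots a_k$ for some $a_1,\ldots,a_k\in\mathscr A(H)$ (the empty product, $k=0$, being $1_H$). Set $\mathscr L(H):=\{\mathsf L_H(x): x\in H\}\setminus\{\emptyset\}$ and, for $k\in\mathbb N$, $\mathscr U_k(H):=\bigcup\{L\in\mathscr L(H): k\in L\}$. For subsets of $\mathbb Z$, $X_1+\cdots+X_n:=\{x_1+\cdots+x_n: x_j\in X_j\}$ (empty if some $X_j$ is empty). $\mathbb N^+$ is the set of positive integers. An $I$-word is a finite sequence $i_1\ast\cdots\ast i_n$ of elements of $I$. *)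

(* Defs.v *)
From HB Require Import structures.
From mathcomp Require Import all_boot.
From mathcomp Require Import boolp classical_sets.

Set Implicit Arguments.
Unset Strict Implicit.
Unset Printing Implicit Defensive.

Local Open Scope classical_set_scope.
Local Open Scope group_scope.

Section Factorization.
Variable H : monoidType.
Implicit Types x y a u : H.

Definition is_unit u : Prop := exists v : H, u * v = 1 /\ v * u = 1.

Definition nontrivial_units : Prop := exists u, is_unit u /\ u <> 1.

Definition atom a : Prop :=
  ~ is_unit a /\ forall x y, a = x * y -> is_unit x \/ is_unit y.

Definition length_set x : set nat :=
  [set k | exists a : 'I_k -> H,
             (forall j, atom (a j)) /\ x = \prod_(j < k) a j].

Definition atomic : Prop :=
  forall x, ~ is_unit x ->
    exists n (a : 'I_n.+1 -> H), (forall j, atom (a j)) /\ x = \prod_(j < n.+1) a j.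

Definition length_system : set (set nat) := range length_set `\ set0.

Definition length_union (k : nat) : set nat :=
  \bigcup_(L in [set L | length_system L /\ L k]) L.

End Factorization.

(* Objects of the category AtoMon. The choice structure carried by a monoidType
   is no restriction, by the classical axioms of boolp. *)
HB.mixin Record Monoid_isAtomic M of Monoid M := {
  atomicP : atomic M
}.

#[short(type="atomicMonoidType")]
HB.structure Definition AtomicMonoid := {M of Monoid_isAtomic M & Monoid M}.

(* Morphisms of the category AtoMon. *)
HB.mixin Record isAtomPreserving (M N : monoidType) (f : M -> N) := {
  atom_preserved : forall a : M, atom a -> atom (f a)
}.

#[short(type="atoMonHom")]
HB.structure Definition AtoMonHom (M N : monoidType) :=
  {f of isAtomPreserving M N f & @UMagmaMorphism M N f}.

(* The universal property of the coproduct in AtoMon, with coprojections iota. *)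
Definition is_coproduct (I : Type) (H : I -> atomicMonoidType)
    (C : atomicMonoidType) (iota : forall i, atoMonHom (H i) C) : Prop :=
  forall (M : atomicMonoidType) (f : forall i, atoMonHom (H i) M),
    exists g : atoMonHom C M,
      (forall i, g \o iota i =1 f i) /\
      (forall g' : atoMonHom C M, (forall i, g' \o iota i =1 f i) -> g' =1 g).

Definition consecutive (I : Type) (w : seq I) (a b : I) : Prop :=
  exists u v : seq I, w = u ++ [:: a, b & v].

Definition words (I : Type) (H : I -> atomicMonoidType) : set (seq I) :=
  if `[< exists i j, [/\ i <> j, nontrivial_units (H i)
                               & nontrivial_units (H j)] >] then
    [set w | w <> [::]]
  else if `[< exists! i, nontrivial_units (H i) >] then
    [set w | w <> [::] /\
             forall i, nontrivial_units (H i) -> ~ consecutive w i i]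
  else
    [set w | w <> [::] /\ forall a b, consecutive w a b -> a <> b].

(* X_1 + ... + X_n; length sets are subsets of the natural numbers, so this
   is computed in nat rather than in the integers. *)
Definition sumset (n : nat) (X : 'I_n -> set nat) : set nat :=
  [set (\sum_(j < n) x j)%N | x in [set x : 'I_n -> nat | forall j, X j (x j)]].

(* Tuples (k_1, ..., k_n) of positive integers with sum k. *)
Definition compositions (n k : nat) : set ('I_n -> nat) :=
  [set c | (forall j, 0 < c j)%N /\ (\sum_(j < n) c j)%N = k].

Arguments compositions : clear implicits.

(* Main.v *)
Require Import Defs.
From HB Require Import structures.
From mathcomp Require Import all_boot.
From mathcomp Require Import boolp classical_sets.
From mathcomp Require Import zify.

(** Let [C] be the coproduct of the [H i]. The right-to-left inclusion is
concatenation: the coprojections preserve atoms, so two factorizations of an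
element of each [H i_j], of lengths [k_j] and [l_j], give two factorizations
of the product of the images in [C], of lengths [sum k_j] and [sum l_j].

The other inclusion needs normal forms. Let [F] be the free product of the
[H i], realized as reduced words: sequences of non-identity letters in which
neighbours come from different factors. Once [F] is known to be an atomic
monoid into which every [H i] maps with atoms going to atoms, the universal
property yields an atom-preserving homomorphism from [C] to [F], so an element
of [C] with factorizations of lengths [k] and [l] has an image in [F] with the
same property.

An atom of [F] is an atom of some [H i] multiplied on both sides by units of
[F], and those units may change the reduced word a lot. The argument therefore
avoids describing atoms and follows lengths only, up to units. In an atomic
monoid, let [x] have unit length [k] when [x] is a unit times a product of [k]
atoms: units then have length 0 only, and a non-unit has its usual lengths,
since a unit is absorbed by a neighbouring atom. In [F], let a reduced word have
length [k] when its letters have unit lengths adding up to [k]. Multiplying by a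
letter merges it with at most one letter, so these lengths add up in products
([word_length_act]). A short list of axioms, [length_relation], suffices to
recover units, atoms and factorization lengths from such a many-valued length
([lr_atom], [lr_of_length_set]); it holds in [H i] ([unit_length_relation]),
passes from the letters to [F] ([free_product_length_relation]), and shows at
one stroke that [F] is atomic and that [H i] is sent to [F] with atoms going
to atoms.

Hence two factorizations in [F] of a word, of lengths [k] and [l], split along
its non-unit letters into lengths in the factors ([word_length_factors]).
There remains to see that the indices of the non-unit letters form an admissible
word: two successive non-unit letters with the same index are separated in the
reduced word by a unit letter, which is a non-trivial unit of another factor
([nonunit_word_consecutive]). *)
Set Implicit Arguments.
Unset Strict Implicit.
Unset Printing Implicit Defensive.

Local Open Scope classical_set_scope.
Local Open Scope group_scope.

(** * Products of atoms *)

Section ProductsOfAtoms.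
Variable M : monoidType.
Implicit Types x y u : M.

Lemma unit1 : is_unit (1 : M).
Proof. by exists 1; rewrite mulg1. Qed.

Lemma unitM x y : is_unit x -> is_unit y -> is_unit (x * y).
Proof.
move=> [x' [xx' x'x]] [y' [yy' y'y]]; exists (y' * x'); split.
  by rewrite mulgA -(mulgA x) yy' mulg1.
by rewrite mulgA -(mulgA y') x'x mulg1.
Qed.

Lemma unit_atomM u x : is_unit u -> atom x -> atom (u * x).
Proof.
move=> uu [xN xI]; case: (uu) => u' [uu' u'u]; split.
  move=> ux; apply: xN; have -> : x = u' * (u * x) by rewrite mulgA u'u mul1g.
  by apply: unitM => //; exists u.
move=> y z E; have /xI : x = (u' * y) * z by rewrite -mulgA -E mulgA u'u mul1g.
case=> [u'y|]; last by right.
left; have -> : y = u * (u' * y) by rewrite mulgA uu' mul1g.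
exact: unitM.
Qed.

Lemma atom_unitM x u : is_unit u -> atom x -> atom (x * u).
Proof.
move=> uu [xN xI]; case: (uu) => u' [uu' u'u]; split.
  move=> ux; apply: xN; have -> : x = (x * u) * u' by rewrite -mulgA uu' mulg1.
  by apply: unitM => //; exists u.
move=> y z E; have /xI : x = y * (z * u') by rewrite mulgA -E -mulgA uu' mulg1.
case=> [|zu']; first by left.
right; have -> : z = (z * u') * u by rewrite -mulgA u'u mulg1.
exact: unitM.
Qed.

Lemma length_set0 x : length_set x 0 <-> x = 1.
Proof.
split=> [[a [_ ->]]|->]; first by rewrite big_ord0.
by exists (fun=> 1); split=> [[]//|]; rewrite big_ord0.
Qed.

Lemma length_setS x k :
  length_set x k.+1 <-> exists a y, [/\ atom a, length_set y k & x = a * y].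
Proof.
split=> [[a [aP ->]]|[a [_ [aP [b [bP ->]] ->]]]].
  exists (a ord0), (\prod_(j < k) a (lift ord0 j)).
  by split=> //; [exists (fun j => a (lift ord0 j))|rewrite big_ord_recl].
exists (fun j => oapp b a (unlift ord0 j)); split=> [j|].
  by case: unliftP => [j' _|_] /=.
rewrite big_ord_recl unlift_none /=; congr (_ * _).
by apply: eq_bigr => j _; rewrite liftK.
Qed.

Lemma length_setM x y k l :
  length_set x k -> length_set y l -> length_set (x * y) (k + l).
Proof.
elim: k x => [|k IHk] x; first by move/length_set0 => ->; rewrite mul1g.
move=> /length_setS[a [z [aP zk ->]]] yl; apply/length_setS.
by exists a, (z * y); split; rewrite ?mulgA//; exact: IHk.
Qed.

Lemma length_set1 x : length_set x 1%N <-> atom x.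
Proof.
rewrite length_setS; split=> [[a [y [aP /length_set0-> ->]]]|xP].
  by rewrite mulg1.
by exists x, 1; split; rewrite ?length_set0 ?mulg1.
Qed.

Lemma length_unionP k l :
  length_union M k l <-> exists x : M, length_set x k /\ length_set x l.
Proof.
split=> [[_ [[[x _ <-] _] xk] xl]|[x [xk xl]]]; first by exists x.
exists (length_set x) => //; split=> //; split; first by exists x.
by move=> x0; rewrite x0 in xl.
Qed.

End ProductsOfAtoms.

Lemma atom_preserving_length_set (M N : monoidType) (f : atoMonHom M N) x k :
  length_set x k -> length_set (f x) k.
Proof.
elim: k x => [|k IHk] x; first by rewrite !length_set0 => ->; rewrite gmulf1.
move=> /length_setS[a [y [aP yk ->]]]; apply/length_setS.
exists (f a), (f y); split; [exact: atom_preserved|exact: IHk|exact: gmulfM].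
Qed.

(** * Many-valued length functions *)

(** These axioms characterize the relation [x] is a unit times a product of [k]
atoms, without mentioning atoms: units are the elements of length 0 and atoms
those of length 1. [lr_rigid] is what makes elements of length 1 irreducible
although lengths are in general not unique; [lr_one] makes the monoid
Dedekind-finite. *)
Record length_relation (M : monoidType) (P : M -> nat -> Prop) : Prop := {
  lr_total x : exists k, P x k;
  lr_mul x y k l : P x k -> P y l -> P (x * y) (k + l);
  lr_one k : P 1 k -> k = 0;
  lr_zero x : P x 0 -> is_unit x;
  lr_split x k : P x k.+1 -> exists y z, [/\ P y 1%N, P z k & x = y * z];
  lr_rigid x k : P x 1%N -> P x k -> k = 1%N
}.

Section LengthRelation.
Variables (M : monoidType) (P : M -> nat -> Prop).
Hypothesis PL : length_relation P.

(** Lengths add up, so a length of [x] and one of its inverse add up to a length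
of 1. *)
Lemma lr_unit x k : is_unit x -> P x k -> k = 0.
Proof.
move=> [y [xy1 _]] xk; have [l yl] := lr_total PL y.
by have := lr_mul PL xk yl; rewrite xy1 => /(lr_one PL); lia.
Qed.

(** A longer element splits by [lr_split] into two factors of positive length,
which are non-units; conversely a product of length 1 has a factor of length 0,
by [lr_rigid]. *)
Lemma lr_atom x : atom x <-> P x 1%N.
Proof.
split=> [[xN xI]|x1].
  have [[|[|k]] xk] := lr_total PL x; [by case: xN; exact: lr_zero xk|by []|].
  have [y [z [y1 zk /xI[]]]] := lr_split PL xk.
    by move/lr_unit => /(_ _ y1).
  by move/lr_unit => /(_ _ zk).
split=> [/lr_unit/(_ x1)//|y z E].
have [m ym] := lr_total PL y; have [n zn] := lr_total PL z.
have : P x (m + n) by rewrite E; exact: lr_mul.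
move/(lr_rigid PL x1) => mn.
have [m0|n0] : m = 0 \/ n = 0 by lia.
  by left; apply: (lr_zero PL); rewrite -m0.
by right; apply: (lr_zero PL); rewrite -n0.
Qed.

Lemma lr_of_length_set x k : length_set x k -> P x k.
Proof.
elim: k x => [|k IHk] x.
  rewrite length_set0 => ->; have [k k1] := lr_total PL 1.
  by rewrite -(lr_one PL k1).
move=> /length_setS[a [y [/lr_atom a1 /IHk yk ->]]].
exact: lr_mul a1 yk.
Qed.

(** Length 0 is excluded because a unit other than 1 has length 0 but is not an
empty product of atoms. *)
Lemma length_set_of_lr x k : P x k.+1 -> length_set x k.+1.
Proof.
elim: k x => [|k IHk] x xk; first by apply/length_set1/lr_atom.
have [y [z [y1 zk ->]]] := lr_split PL xk; apply/length_setS.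
by exists y, z; split=> //; [exact/lr_atom|exact: IHk].
Qed.

Lemma lr_atomic : atomic M.
Proof.
move=> x xN; have [[|k] xk] := lr_total PL x; first by case: xN; exact: lr_zero xk.
by exists k; exact: length_set_of_lr xk.
Qed.

End LengthRelation.

(** * Lengths up to a unit in an atomic monoid *)

(** Allowing a unit in front gives units the length 0; otherwise units other than
1 would have no length, and lengths could not be computed letter by letter. *)
Definition unit_length (M : monoidType) (x : M) (k : nat) : Prop :=
  exists u y, [/\ is_unit u, length_set y k & x = u * y].

Section UnitLength.
Variable M : monoidType.
Hypothesis M_atomic : atomic M.
Implicit Types x y : M.

(** If there is an atom, the last one absorbs [u]; otherwise [u] becomes the
unit in front. *)
Lemma length_set_unit y u k : is_unit u -> length_set y k ->
  unit_length (y * u) k.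
Proof.
case: k => [|k] uu yk.
  exists u, 1; split=> //; first exact/length_set0.
  by move/length_set0: yk => ->; rewrite mul1g mulg1.
exists 1, (y * u); split; [exact: unit1| |by rewrite mul1g].
elim: k y yk => [|k IHk] y; first by rewrite !length_set1; exact: atom_unitM.
move=> /length_setS[a [z [aP /IHk zk ->]]]; apply/length_setS.
by exists a, (z * u); rewrite mulgA.
Qed.

Lemma unit_lengthM x y k l :
  unit_length x k -> unit_length y l -> unit_length (x * y) (k + l).
Proof.
move=> [u [p [uu pk ->]]] [v [q [vu ql ->]]].
have [w [r [wu rk pv]]] := length_set_unit vu pk.
exists (u * w), (r * q); split; [exact: unitM|exact: length_setM|].
by rewrite -!mulgA; congr (_ * _); rewrite !mulgA pv.
Qed.

(** Otherwise 1 is a unit times a product starting with an atom [a], and [a] has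
a right inverse [w]. Then [a = a * (w * a)] and irreducibility make the
idempotent [w * a] a unit, hence 1, and [a] is a unit. *)
Lemma unit_length1 k : unit_length (1 : M) k -> k = 0.
Proof.
move=> [u [y [[u' [uu' u'u]] yk E]]]; case: k yk => // k.
move=> /length_setS[a [z [[aN aI] _ ya]]].
have aw : a * (z * u) = 1.
  have -> : a * (z * u) = u' * (u * y) * u by rewrite mulgA -ya mulgA u'u mul1g.
  by rewrite -E mulg1.
have /aI[//|] : a = a * (z * u * a) by rewrite mulgA aw mul1g.
move=> [v [wav vwa]]; case: aN; exists (z * u); split=> //.
(* A unit [z * u * a] that is idempotent equals 1. *)
have idem : z * u * a * (z * u * a) = z * u * a.
  by rewrite -mulgA (mulgA a) aw mul1g.
by rewrite -[LHS]mulg1 -wav mulgA idem.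
Qed.

Lemma unit_length_total x : exists k, unit_length x k.
Proof.
have [xu|/M_atomic[k xk]] := pselect (is_unit x).
  by exists 0, x, 1; split; rewrite ?length_set0 ?mulg1.
by exists k.+1, 1, x; split; rewrite ?mul1g//; exact: unit1.
Qed.

Lemma unit_length_unit x k : is_unit x -> unit_length x k -> k = 0.
Proof.
move=> [y [xy1 _]] xk; have [l yl] := unit_length_total y.
by have := unit_lengthM xk yl; rewrite xy1 => /unit_length1; lia.
Qed.

Lemma unit_length_relation : length_relation (@unit_length M).
Proof.
split.
- exact: unit_length_total.
- exact: unit_lengthM.
- exact: unit_length1.
- by move=> x [u [y [uu /length_set0-> ->]]]; rewrite mulg1.
- move=> x k [u [y [uu /length_setS[a [z [aP zk ->]]] ->]]].
  exists (u * a), z; split; rewrite ?mulgA//.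
    by exists u, a; split=> //; exact/length_set1.
  by exists 1, z; split; rewrite ?mul1g//; exact: unit1.
move=> x k [u [y [uu /length_set1 yP ->]]].
have [xN xI] := unit_atomM uu yP; move: xN xI.
set z := u * y => zN zI [v [t [vu tk E]]].
case: k tk => [|[|k]] // tk.
  by case: zN; move/length_set0: tk E => -> ->; rewrite mulg1.
move: tk E => /length_setS[a [s [aP sk ->]]]; rewrite mulgA => E.
have [/unit_length_unit vaU|/unit_length_unit sU] := zI _ _ E.
  suff : unit_length (v * a) 1%N by move/vaU.
  by exists v, a; split=> //; exact/length_set1.
suff : unit_length s k.+1 by move/sU.
by exists 1, s; split; rewrite ?mul1g//; exact: unit1.
Qed.

Lemma unit_length_nonunit x k : ~ is_unit x -> unit_length x k ->
  (0 < k)%N /\ length_set x k.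
Proof.
case: k => [xN /(lr_zero unit_length_relation)//|k _ xk]; split=> //.
exact: length_set_of_lr unit_length_relation _ _ xk.
Qed.

End UnitLength.

(** * The free product *)

Section FreeProduct.
Variables (I : Type) (H : I -> atomicMonoidType).
Implicit Types (i j : I).

Definition letter := {i : I & H i}.
Implicit Types (w : seq letter).

Definition starts i w : Prop := if w is l :: _ then projT1 l = i else False.

Fixpoint reduced w : Prop :=
  if w is l :: w' then
    [/\ projT2 l <> 1, ~ starts (projT1 l) w' & reduced w']
  else True.

(** Adds a letter that may be the identity in front of a word that does not start
in the same factor. *)
Definition push i (g : H i) w : seq letter :=
  if pselect (g = 1) then w else existT _ i g :: w.

(** Left multiplication of a reduced word by an element of one factor. Working
with the action of each factor on reduced words (van der Waerden's method)
makes associativity of the product a consequence of [actM]. *)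
Definition act i (g : H i) w : seq letter :=
  if w is existT j h :: w' then
    if pselect (j = i) is left e then push (g * ecast k (H k) e h) w'
    else push g w
  else push g w.

Definition concat v w : seq letter :=
  foldr (fun l : letter => act (projT2 l)) w v.

Lemma push1 i w : push (1 : H i) w = w.
Proof. by rewrite /push; case: pselect. Qed.

Lemma push_neq1 i (g : H i) w : g <> 1 -> push g w = existT _ i g :: w.
Proof. by rewrite /push; case: pselect. Qed.

Lemma reduced_push i (g : H i) w :
  ~ starts i w -> reduced w -> reduced (push g w).
Proof. by rewrite /push; case: pselect. Qed.

(** Relative to a factor [i], every reduced word is an element of [H i],
possibly 1, followed by a word that does not start in [H i]. On this form the
action of [H i] is left multiplication ([act_push]), which removes all case
distinctions below. *)
Lemma reduced_pushP i w : reduced w ->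
  exists h w', [/\ w = push (h : H i) w', ~ starts i w' & reduced w'].
Proof.
case: w => [_|[j h] w' /= [h1 w'j rw']]; first by exists 1, [::]; rewrite push1; split=> //; case.
have [e|ne] := pselect (j = i).
  by subst j; exists h, w'; split=> //; rewrite push_neq1.
by exists 1, (existT _ j h :: w'); rewrite push1; split.
Qed.

Lemma act_push i (g h : H i) w :
  ~ starts i w -> act g (push h w) = push (g * h) w.
Proof.
move=> wi; have [->|h1] := pselect (h = 1).
  rewrite push1 mulg1; case: w wi => // -[j k] w /= ji.
  by case: pselect.
rewrite [in LHS]push_neq1 //=; case: pselect => // e.
by rewrite (Prop_irrelevance e erefl).
Qed.

Lemma act_reduced i (g : H i) w : ~ starts i w -> act g w = push g w.
Proof. by move=> wi; rewrite -[in LHS](@push1 i w) act_push // mulg1. Qed.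

Lemma reduced_act i (g : H i) w : reduced w -> reduced (act g w).
Proof.
move=> /(reduced_pushP i)[h [w' [-> wi rw]]].
by rewrite act_push //; exact: reduced_push.
Qed.

Lemma act1 i w : reduced w -> act (1 : H i) w = w.
Proof.
by move=> /(reduced_pushP i)[h [w' [-> wi rw]]]; rewrite act_push // mul1g.
Qed.

Lemma actM i (g h : H i) w : reduced w -> act (g * h) w = act g (act h w).
Proof.
by move=> /(reduced_pushP i)[k [w' [-> wi rw]]]; rewrite !act_push // mulgA.
Qed.

Lemma reduced_concat v w : reduced w -> reduced (concat v w).
Proof. by move=> rw; elim: v => //= l v IHv; exact: reduced_act. Qed.

Lemma concat_act i (g : H i) v w : reduced v -> reduced w ->
  concat (act g v) w = act g (concat v w).
Proof.
have concat_push (h : H i) u :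
    reduced w -> concat (push h u) w = act h (concat u w).
  move=> rw; have [->|h1] := pselect (h = 1); last by rewrite push_neq1.
  by rewrite push1 act1 //; exact: reduced_concat.
move=> /(reduced_pushP i)[h [v' [-> vi _]]] rw.
by rewrite act_push // !concat_push // actM //; exact: reduced_concat.
Qed.

(** It suffices that concatenation commutes with the action of a letter. *)
Lemma concatA u v w : reduced v -> reduced w ->
  concat u (concat v w) = concat (concat u v) w.
Proof.
move=> rv rw; elim: u => //= l u ->.
by rewrite concat_act //; exact: reduced_concat.
Qed.

Lemma concat_nil w : reduced w -> concat w [::] = w.
Proof.
elim: w => //= -[i g] w IHw /= [g1 wi rw].
by rewrite IHw // act_reduced // push_neq1.
Qed.

Record free_product : Type :=
  FreeProduct { word : seq letter; word_reduced : reduced word }.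

Lemma word_inj : injective word.
Proof.
by move=> [v rv] [w rw] /= E; subst w; rewrite (Prop_irrelevance rv rw).
Qed.

HB.instance Definition _ := gen_eqMixin free_product.
HB.instance Definition _ := gen_choiceMixin free_product.

Definition free_one : free_product := @FreeProduct [::] Logic.I.

Definition free_mul (x y : free_product) : free_product :=
  FreeProduct (reduced_concat (word x) (word_reduced y)).

Lemma free_mulA : associative free_mul.
Proof.
by move=> x y z; apply: word_inj; apply: concatA; exact: word_reduced.
Qed.

Lemma free_1mul : left_id free_one free_mul.
Proof. by move=> x; exact: word_inj. Qed.

Lemma free_mul1 : right_id free_one free_mul.
Proof. by move=> x; apply: word_inj; apply: concat_nil; exact: word_reduced. Qed.

HB.instance Definition _ :=
  isMonoid.Build free_product free_mulA free_1mul free_mul1.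

Definition incl i (g : H i) : free_product :=
  @FreeProduct (act g [::]) (@reduced_act i g [::] Logic.I).

Lemma word_incl_mul i (g : H i) x : word (incl g * x) = act g (word x).
Proof.
rewrite /=; have [->|g1] := pselect (g = 1); last by rewrite push_neq1.
by rewrite push1 act1 //; exact: word_reduced.
Qed.

Lemma incl_monoid_morphism i : monoid_morphism (@incl i).
Proof.
split=> [|g h]; apply: word_inj; first exact: push1.
by rewrite word_incl_mul [RHS]/= -[push h _]/(act h [::]) -actM.
Qed.

HB.instance Definition _ i :=
  isUMagmaMorphism.Build (H i) free_product (@incl i) (@incl_monoid_morphism i).

Fixpoint word_length w (k : nat) : Prop :=
  if w is l :: w' then
    exists m n, [/\ unit_length (projT2 l) m, word_length w' n & k = (m + n)%N]
  else k = 0%N.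

(** When [g] is the identity, [push] adds no letter, but 1 has unit length 0 and
no other. *)
Lemma word_length_push i (g : H i) w k : word_length (push g w) k <->
  exists m n, [/\ unit_length g m, word_length w n & k = (m + n)%N].
Proof.
have [->|g1] := pselect (g = 1); last by rewrite push_neq1.
rewrite push1; split=> [wk|[m [n [/unit_length1-> ? ->]]]//].
have ULR := unit_length_relation (@atomicP (H i)).
have [m m1] := lr_total ULR 1.
move: (unit_length1 m1) => m0; rewrite m0 in m1.
by exists 0%N, k.
Qed.

(** The new letter merges with at most the first letter of the word, and unit
lengths add up in [H i]. *)
Lemma word_length_act i (g : H i) w m n : reduced w ->
  unit_length g m -> word_length w n -> word_length (act g w) (m + n).
Proof.
move=> /(reduced_pushP i)[h [w' [-> wi rw]]] gm.
move=> /word_length_push[p [q [hp w'q ->]]]; rewrite act_push //.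
apply/word_length_push; exists (m + p)%N, q; split; rewrite ?addnA//.
exact: unit_lengthM.
Qed.

Lemma word_length_concat v w k l : reduced w ->
  word_length v k -> word_length w l -> word_length (concat v w) (k + l).
Proof.
move=> rw; elim: v k => [k -> //|g v IHv k /= [m [n [gm vn ->]]] wl].
rewrite -addnA; apply: word_length_act => //; first exact: reduced_concat.
exact: IHv.
Qed.

Lemma word_length_incl i (g : H i) m :
  unit_length g m -> word_length (word (incl g)) m.
Proof. by move=> gm; apply/word_length_push; exists m, 0%N; rewrite addn0. Qed.

(** Induction on the reduced word, keeping the information that no letters merge. *)
Lemma free_product_ind (Q : free_product -> Prop) : Q 1 ->
  (forall i (g : H i) x, word (incl g * x) = existT _ i g :: word x ->
     Q x -> Q (incl g * x)) ->
  forall x, Q x.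
Proof.
move=> Q1 QM [w]; elim: w => [|[i g] w IHw] rw.
  by have -> : FreeProduct rw = 1 by exact: word_inj.
have [g1 wi rw'] := rw; pose x := FreeProduct rw'.
have E : word (incl g * x) = existT _ i g :: w.
  by rewrite word_incl_mul act_reduced // push_neq1.
have -> : FreeProduct rw = incl g * x by apply: word_inj; rewrite E.
by apply: QM; [exact: E|exact: IHw].
Qed.

(** In a word of length at most 1 every letter has length 0 or 1, and such letters
have only one length. *)
Lemma word_length_le1 w k l :
  (k <= 1)%N -> word_length w k -> word_length w l -> l = k.
Proof.
elim: w k l => [k l _ -> -> //|[i g] w IHw k l k1].
move=> [m [n [gm wn km]]] [p [q [gp wq ->]]]; rewrite km in k1 *.
have ULR := unit_length_relation (@atomicP (H i)).
have -> : q = n by apply: IHw wn wq; lia.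
have [m0|m1] : m = 0%N \/ m = 1%N by lia.
  rewrite m0 in gm *; have gU := lr_zero ULR gm.
  by rewrite (lr_unit ULR gU gp).
by rewrite m1 in gm *; rewrite (lr_rigid ULR gm gp).
Qed.

Lemma incl_unit i (g : H i) : is_unit g -> is_unit (incl g).
Proof.
move=> [h [gh hg]]; exists (incl h).
by rewrite -!gmulfM gh hg !gmulf1.
Qed.

(** For splitting, the factor of length 1 is cut from the first letter of positive
length; the letters before it are units and are kept in that factor. *)
Lemma free_product_length_relation :
  length_relation (fun x : free_product => word_length (word x)).
Proof.
have ULR i := unit_length_relation (@atomicP (H i)).
split.
- move=> x; elim: (word x) => [|[i g] w [n wn]]; first by exists 0%N.
  by have [m gm] := lr_total (ULR i) g; exists (m + n)%N, m, n.
- by move=> x y k l; apply: word_length_concat; exact: word_reduced.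
- by [].
- elim/free_product_ind => [_|i g x E IHx]; first exact: unit1.
  rewrite E => -[[|m] [[|n] [gm xn //]]] _.
  by apply: unitM; [exact: incl_unit (lr_zero (ULR i) gm)|exact: IHx].
- elim/free_product_ind => [//|i g x E IHx] k; rewrite E.
  move=> /= [[|m] [n [gm xn kn]]].
    rewrite add0n in kn; rewrite -kn in xn; have [y [z [y1 zk ->]]] := IHx _ xn.
    exists (incl g * y), z; rewrite mulgA; split=> //.
    apply: (@word_length_concat _ _ 0%N 1%N) => //; first exact: word_reduced.
    exact: word_length_incl.
  have [a [h [a1 hm ->]]] := lr_split (ULR i) gm.
  exists (incl a), (incl h * x); rewrite mulgA -gmulfM.
  move: kn; rewrite addSn => -[->]; split=> //.
    exact: word_length_incl.
  apply: word_length_concat => //; first exact: word_reduced.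
  exact: word_length_incl.
by move=> x k; exact: word_length_le1.
Qed.

HB.instance Definition _ := Monoid_isAtomic.Build free_product
  (lr_atomic free_product_length_relation).

Lemma incl_atom i (a : H i) : atom a -> atom (incl a).
Proof.
move=> aP; apply/(lr_atom free_product_length_relation)/word_length_incl.
exact/(lr_atom (unit_length_relation (@atomicP (H i)))).
Qed.

HB.instance Definition _ i :=
  isAtomPreserving.Build (H i) free_product (@incl i) (@incl_atom i).

(** * The word of non-unit letters *)

Fixpoint nonunit_word w : seq I :=
  if w is existT i g :: w' then
    if pselect (is_unit g) then nonunit_word w' else i :: nonunit_word w'
  else [::].

(** In a reduced word the letter after a non-unit of [H i] belongs to some other
[H j] and is not 1. If the next non-unit is again in [H i], that letter is a
unit. *)
Lemma nonunit_word_consecutive w i : reduced w ->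
  consecutive (nonunit_word w) i i ->
  exists j, j <> i /\ nontrivial_units (H j).
Proof.
elim: w => [_ [[|? ?] [v //]]|[k g] w IHw [_ wk rw] /=].
case: pselect => [gU|gN]; first exact: IHw.
move=> [[|a u] [v [ki E]]]; last by apply: IHw => //; exists u, v.
subst k; case: w wk rw {IHw} E => //= -[j h] w ji [h1 _ _].
case: pselect => [hU _|hN [/ji//]].
by exists j; split=> //; exists h.
Qed.

(** If two factors have non-trivial units, all words are allowed. Otherwise a
repetition [i, i] would produce a non-trivial unit in some [H j] with
[j <> i]: this contradicts uniqueness when [i] is the only index with
non-trivial units, and is impossible when there is none. *)
Lemma nonunit_word_words w : reduced w -> nonunit_word w <> [::] ->
  words H (nonunit_word w).
Proof.
move=> rw wN; rewrite /words; case: asboolP => // two.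
case: asboolP => [[i [iU uniq_i]]|none] /=.
  split=> // a aU /(nonunit_word_consecutive rw)[j [ja jU]].
  by apply: ja; rewrite -(uniq_i _ aU) -(uniq_i _ jU).
split=> // a b + ab; rewrite -ab => /(nonunit_word_consecutive rw)[j [_ jU]].
apply: none; exists j; split=> // i iU.
by have [//|ji] := pselect (j = i); case: two; exists j, i.
Qed.

(** The list [s] records, for each non-unit letter, its index and its lengths in
the two factorizations; unit letters contribute 0 to both. *)
Lemma word_length_factors w k l : word_length w k -> word_length w l ->
  exists s : seq (I * (nat * nat)),
    [/\ map fst s = nonunit_word w,
        sumn (map (fun t => t.2.1) s) = k,
        sumn (map (fun t => t.2.2) s) = l &
        forall t0 (j : nat), (j < size s)%N -> let t := nth t0 s j in
          (0 < t.2.1)%N /\ length_union (H t.1) t.2.1 t.2.2].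
Proof.
elim: w k l => [k l -> ->|[i g] w IHw k l]; first by exists [::].
move=> /= [m [n [gm wn ->]]] [p [q [gp wq ->]]].
have Hi := @atomicP (H i).
have [s [sw sk sl sP]] := IHw _ _ wn wq.
case: pselect => [gU|gN].
  by rewrite (unit_length_unit Hi gU gm) (unit_length_unit Hi gU gp); exists s.
have [m0 gm'] := unit_length_nonunit Hi gN gm.
have [_ gp'] := unit_length_nonunit Hi gN gp.
exists ((i, (m, p)) :: s); split; rewrite /= ?sw ?sk ?sl//.
move=> t0 [_|j js] /=; last exact: sP.
by split=> //; apply/length_unionP; exists g.
Qed.

End FreeProduct.

Lemma factors_sumset (I : Type) (H : I -> atomicMonoidType)
    (s : seq (I * (nat * nat))) (w := map fst s) :
  (forall t0 (j : nat), (j < size s)%N -> let t := nth t0 s j in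
     (0 < t.2.1)%N /\ length_union (H t.1) t.2.1 t.2.2) ->
  (\bigcup_(c in compositions (size w) (sumn (map (fun t => t.2.1) s)))
     sumset (fun j : 'I_(size w) =>
               length_union (H (tnth (in_tuple w) j)) (c j)))
  (sumn (map (fun t => t.2.2) s)).
Proof.
move=> sP; have ws : size w = size s by rewrite size_map.
have nth_sum (f : I * (nat * nat) -> nat) :
    (\sum_(j < size w) nth 0 (map f s) j)%N = sumn (map f s).
  by rewrite sumnE (big_nth 0%N) big_mkord size_map ws.
exists (fun j => nth 0%N (map (fun t => t.2.1) s) j).
  split=> [j|]; last exact: nth_sum.
  have js : (j < size s)%N by rewrite -ws.
  have t0 : I * (nat * nat) by case: (s) js => [|t ?].
  by rewrite (nth_map t0) //; exact: (sP t0 j js).1.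
exists (fun j => nth 0%N (map (fun t => t.2.2) s) j); last exact: nth_sum.
move=> j; have js : (j < size s)%N by rewrite -ws.
have t0 : I * (nat * nat) by case: (s) js => [|t ?].
rewrite (tnth_nth t0.1) /= !(nth_map t0) //.
exact: (sP t0 j js).2.
Qed.

Theorem theorem4p11 (I : Type) (H : I -> atomicMonoidType)
    (C : atomicMonoidType) (iota : forall i : I, atoMonHom (H i) C)
    (I_nonempty : inhabited I) (C_coproduct : is_coproduct iota)
    (k : nat) (k_gt0 : (0 < k)%N) :
  length_union C k =
    \bigcup_(w in words H)
      \bigcup_(c in compositions (size w) k)
        sumset (fun j : 'I_(size w) =>
                  length_union (H (tnth (in_tuple w) j)) (c j)).
Proof.
apply/seteqP; split=> l.
  move=> /length_unionP[x [xk xl]].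
  have [g _] := C_coproduct (free_product H) (fun i => @incl I H i).
  have FLR := free_product_length_relation H.
  have /(lr_of_length_set FLR) gxk := atom_preserving_length_set g xk.
  have /(lr_of_length_set FLR) gxl := atom_preserving_length_set g xl.
  have [s [sw sk sl sP]] := word_length_factors gxk gxl.
  have := factors_sumset sP; rewrite sk sl sw => kl.
  exists (nonunit_word (word (g x))) => //.
  apply: nonunit_word_words; first exact: word_reduced.
  by rewrite -sw; case: s sk {sw sl sP} => // sk; rewrite -sk in k_gt0.
move=> [w _ [c [_ <-] [n nP <-]]].
have xE j := cid ((length_unionP _ _ _).1 (nP j)).
pose x j := projT1 (xE j); have xP j := projT2 (xE j).
apply/length_unionP; exists (\prod_(j < size w) iota _ (x j)).
have prodP (m : 'I_(size w) -> nat) : (forall j, length_set (x j) (m j)) ->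
    length_set (\prod_(j < size w) iota _ (x j)) (\sum_(j < size w) m j).
  move=> mP; elim/big_rec2: _ => [|j y p _ py]; first exact/length_set0.
  by apply: length_setM => //; exact: atom_preserving_length_set.
by split; apply: prodP => j; have [] := xP j.
Qed.
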